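(* Let $H$ be a graph of order at least $2$. If there exists a vertex $x$ of $H$ of degree $|V(H)|-1$ that does not belong to any $2$-adjacency basis of $H$, then $\operatorname{adim}_2(K_1+H)=\operatorname{adim}_2(H)+2$.
   Context: All graphs are finite and simple. The join $K_1+H$ is obtained from $H$ by adding a new vertex adjacent to all vertices of $H$. For a graph $G=(V,E)$, $d_{G,2}(x,y)=\min\{d_G(x,y),2\}$ with $d_G$ the shortest-path distance ($\infty$ between different components). For distinct $x,y$, $\mathcal{C}_G(x,y)=\{z\in V: d_{G,2}(x,z)\ne d_{G,2}(y,z)\}$. A set $S\subseteq V$ is a $2$-adjacency generator if $|S\cap\mathcal{C}_G(x,y)|\ge 2$ for all distinct $x,y$; a minimum one is a $2$-adjacency basis, and its cardinality is $\operatorname{adim}_2(G)$. *)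

(* Defs.v *)
From mathcomp Require Import all_boot.

Set Implicit Arguments.
Unset Strict Implicit.
Unset Printing Implicit Defensive.

Record sgraph := SGraph {
  vertex :> finType;
  edge : rel vertex;
  edge_sym : symmetric edge;
  edge_irrefl : irreflexive edge
}.
Arguments edge {G} : rename.

Section Adjacency.
Variable G : sgraph.
Implicit Types (x y z : G) (S : {set G}) (k : nat).

Definition degree x : nat := #|[set y | edge x y]|.

Definition walk_of_length x y k : bool :=
  [exists p : k.-tuple G, path edge x p && (last x p == y)].

Lemma connect_walk x y : connect edge x y -> exists k, walk_of_length x y k.
Proof.
case/connectP=> p pp ->; exists (size p).
by apply/existsP; exists (in_tuple p); rewrite /= pp eqxx.
Qed.

(* [None] stands for the infinite distance between different components. *)
Definition dist x y : option nat :=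
  match @idP (connect edge x y) with
  | ReflectT xy => Some (ex_minn (connect_walk xy))
  | ReflectF _ => None
  end.

Definition dist2 x y : nat := if dist x y is Some d then minn d 2 else 2.

Definition distinguishers x y : {set G} := [set z | dist2 x z != dist2 y z].

Definition adj2_generator S : bool :=
  [forall x, forall y, (x != y) ==> (2 <= #|S :&: distinguishers x y|)].

Definition adj2_basis S : bool :=
  adj2_generator S && [forall S', adj2_generator S' ==> (#|S| <= #|S'|)].

Lemma dist2_eq0 x y : (dist2 x y == 0) = (x == y).
Proof.
rewrite /dist2 /dist; case: {-}_ / idP => [xy|nxy].
  case: ex_minnP => d /existsP[p /andP[pp /eqP lp]] dmin.
  apply/idP/eqP=> [|exy].
    case: d p pp lp dmin => [|[|d]] // p _ lp _ _.
    by rewrite -lp (tuple0 p).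
  suff /dmin : walk_of_length x y 0 by rewrite leqn0 => /eqP->.
  by apply/existsP; exists [tuple]; rewrite /= exy eqxx.
by apply/esym/negP => /eqP exy; apply: nxy; rewrite exy connect0.
Qed.

Lemma adj2_generator_setT : adj2_generator [set: G].
Proof.
apply/forallP=> x; apply/forallP=> y; apply/implyP=> nxy.
rewrite setTI; apply: leq_trans (_ : #|[set x; y]| <= _).
  by rewrite cards2 nxy.
apply/subset_leq_card/subsetP=> z; rewrite !inE => /orP[]/eqP->.
  apply: contraNneq nxy => e.
  by rewrite eq_sym -dist2_eq0 -e dist2_eq0.
by apply: contraNneq nxy => e; rewrite -dist2_eq0 e dist2_eq0.
Qed.

(* The default [setT] is a generator by [adj2_generator_setT], so this is
   the true minimum. *)
Definition adim2 : nat := #|[arg min_(S < [set: G] | adj2_generator S) #|S|]|.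

Lemma card_adj2_basis S : adj2_basis S -> #|S| = adim2.
Proof.
case/andP=> gS /forallP minS; rewrite /adim2.
case: arg_minnP => [|S' gS' minS']; first exact: adj2_generator_setT.
by apply/eqP; rewrite eqn_leq minS' // andbT (implyP (minS S')).
Qed.

End Adjacency.

Section Join.
Variable H : sgraph.

(* [None] is the new vertex. *)
Definition K1_join_edge : rel (option H) := fun u v =>
  match u, v with
  | Some x, Some y => edge x y
  | None, None => false
  | _, _ => true
  end.

Lemma K1_join_edge_sym : symmetric K1_join_edge.
Proof. by case=> [x|] [y|] //=; rewrite edge_sym. Qed.

Lemma K1_join_edge_irrefl : irreflexive K1_join_edge.
Proof. by case=> [x|] //=; rewrite edge_irrefl. Qed.

Definition K1_join : sgraph := SGraph K1_join_edge_sym K1_join_edge_irrefl.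

End Join.

(* Main.v *)
Require Import Defs.
From mathcomp Require Import all_boot.

(** Let [v] be the vertex of [K_1] and [x] a universal vertex of [H] lying in
    no 2-adjacency basis.  Truncated distances in [H] and in [K_1 + H] agree on
    [H], and [v] separates no two vertices of [H], so the trace on [H] of a
    generator of [K_1 + H] is a generator of [H].  Only [v] and [x] separate
    [v] from [x], so every generator of [K_1 + H] contains both; its trace
    contains [x], hence is not minimum, which gives the lower bound.
    Conversely, if [B] is a basis of [H] then [B] together with [v] and [x] is
    a generator: since [x] is not in [B], every element of [B] that separates
    [x] from another vertex [a] also separates [v] from [a]. *)

Lemma dist2E (G : sgraph) (x y : G) :
  dist2 x y = if x == y then 0 else if edge x y then 1 else 2.
Proof.
case: eqP => [->|/eqP nxy]; first by apply/eqP; rewrite dist2_eq0.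
have := dist2_eq0 x y; rewrite (negbTE nxy) /dist2 /dist.
case: {-}_ / idP => [xy|nc] d0.
  case: ex_minnP d0 => d /existsP[p /andP[pp /eqP lp]] dmin d0.
  have [exy|nexy] := boolP (edge x y).
    suff /dmin : walk_of_length x y 1 by case: d p pp lp dmin d0 => [|[|d]].
    by apply/existsP; exists [tuple y]; rewrite /= exy eqxx.
  case: d p pp lp dmin d0 => [|[|d]] // p pp lp _ _.
  case/tupleP: p pp lp => z p; rewrite (tuple0 p) /= andbT => exz zy.
  by rewrite -zy exz in nexy.
case: ifP => // /connect1 c; by case: nc.
Qed.

Lemma adj2_generatorP (G : sgraph) (S : {set G}) :
  reflect (forall x y, x != y -> 2 <= #|S :&: distinguishers x y|)
          (adj2_generator S).
Proof.
apply: (iffP forallP) => [gS x y|gS x]; first by move/forallP/(_ y)/implyP: (gS x).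
by apply/forallP=> y; apply/implyP/gS.
Qed.

Lemma distinguishersC (G : sgraph) (x y : G) :
  distinguishers x y = distinguishers y x.
Proof. by apply/setP=> z; rewrite !inE eq_sym. Qed.

Lemma adj2_basis_exists (G : sgraph) : exists S : {set G}, adj2_basis S.
Proof.
case: (arg_minnP (fun S : {set G} => #|S|) (adj2_generator_setT G)) => S gS minS.
by exists S; rewrite /adj2_basis gS; apply/forallP=> S'; apply/implyP/minS.
Qed.

Lemma adim2_le (G : sgraph) (S : {set G}) : adj2_generator S -> adim2 G <= #|S|.
Proof.
have [B bB] := adj2_basis_exists G; rewrite -(card_adj2_basis bB) => gS.
by case/andP: bB => _ /forallP/(_ S)/implyP; apply.
Qed.

Lemma adj2_basisE (G : sgraph) (S : {set G}) :
  adj2_basis S = adj2_generator S && (#|S| == adim2 G).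
Proof.
apply/idP/andP=> [bS|[gS /eqP cS]].
  by rewrite (card_adj2_basis bS); case/andP: bS.
by rewrite /adj2_basis gS; apply/forallP=> S'; apply/implyP; rewrite cS => /adim2_le.
Qed.

Lemma universal_edge (G : sgraph) (x y : G) :
  degree x = #|G| - 1 -> y != x -> edge x y.
Proof.
move=> dx nyx; have sub : [set z | edge x z] \subset [set~ x].
  by apply/subsetP=> z; rewrite !inE; apply: contraTneq => ->; rewrite edge_irrefl.
have : [set z | edge x z] == [set~ x].
  by rewrite eqEcard sub /= cardsC1 -subn1 -dx.
by move/eqP/setP/(_ y); rewrite !inE nyx.
Qed.

Section JoinDistance.
Variable H : sgraph.
Local Notation J := (K1_join H).
Implicit Types (a b : H) (T : {set J}).

Lemma inj_join : injective (Some : H -> J).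
Proof. by move=> a b []. Qed.

(** By [dist2E] only equality and adjacency matter, and the join keeps both on [H]; [None] is at
    distance 1 from either vertex. *)
Lemma join_distinguishers_Some a b :
  distinguishers (Some a : J) (Some b) = Some @: distinguishers a b.
Proof.
apply/setP=> -[z|].
  by rewrite mem_imset ?inE ?dist2E //; exact: inj_join.
rewrite inE !dist2E /=; apply/esym/imsetP; by case.
Qed.

Lemma join_generator_trace T :
  adj2_generator T -> adj2_generator [set a : H | Some a \in T].
Proof.
move/adj2_generatorP=> gT; apply/adj2_generatorP=> a b nab.
have := gT (Some a) (Some b) nab; rewrite join_distinguishers_Some.
rewrite -(card_imset _ inj_join) => /leq_trans; apply.
apply/subset_leq_card/subsetP=> w; rewrite inE => /andP[wT /imsetP[z zab ew]].
by rewrite ew imset_f // inE zab inE -ew wT.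
Qed.

Lemma card_trace T :
  #|T| = (None \in T) + #|[set a : H | Some a \in T]|.
Proof.
rewrite (cardsD1 None) -(card_imset _ inj_join); congr (_ + #|pred_of_set _|).
apply/setP=> -[a|]; rewrite !inE /=.
  by rewrite mem_imset ?inE //; exact: inj_join.
by apply/esym/imsetP; case.
Qed.

End JoinDistance.

Theorem theorem39 (H : sgraph) :
  2 <= #|H| ->
  (exists x : H, degree x = #|H| - 1 /\
     (forall B : {set H}, adj2_basis B -> x \notin B)) ->
  adim2 (K1_join H) = adim2 H + 2.
Proof.
move=> _ [x [dx xB]]; have xE y : y != x -> edge x y by exact: universal_edge.
apply/eqP; rewrite eqn_leq; apply/andP; split.
  have [B bB] := adj2_basis_exists H.
  pose T : {set K1_join H} := None |: (Some @: (x |: B)).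
  have NT : None \notin Some @: (x |: B) by apply/imsetP; case.
  have <- : #|T| = adim2 H + 2.
    rewrite cardsU1 NT card_imset; last exact: inj_join.
    by rewrite cardsU1 xB // (card_adj2_basis bB) addn2.
  case/andP: (bB) => /adj2_generatorP gB _; apply/adim2_le/adj2_generatorP.
  have gN a : 2 <= #|T :&: distinguishers (None : K1_join H) (Some a)|.
    (* [None] is in [T] and separates itself from [Some a], so one further separator [Some c]
       suffices. *)
    have two c : Some c \in T ->
        Some c \in distinguishers (None : K1_join H) (Some a) ->
        2 <= #|T :&: distinguishers (None : K1_join H) (Some a)|.
      move=> cT cD; rewrite (cardsD1 None) (cardsD1 (Some c)).
      by move: cT cD; rewrite !inE !dist2E /= => -> ->.
    have [eax|nax] := eqVneq a x.
      apply: (two x); first by rewrite !inE imset_f ?orbT // !inE eqxx.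
      by rewrite inE !dist2E eax eqxx.
    have /card_gt0P[c] : 0 < #|B :&: distinguishers x a|.
      by apply: ltnW (gB x a _); rewrite eq_sym.
    rewrite !inE => /andP[cB]; rewrite !dist2E => cD.
    have ncx : c != x by apply: contraTneq cB => ->; exact: xB.
    apply: (two c); first by rewrite !inE imset_f ?orbT // !inE cB orbT.
    (* As [c] differs from [x], both [x] in [H] and [None] in the join are at distance 1 from
       [c]. *)
    by move: cD; rewrite [x == c]eq_sym (negbTE ncx) xE // inE !dist2E.
  move=> [a|] [b|] // nab; last by rewrite distinguishersC; exact: gN.
  rewrite join_distinguishers_Some; apply: leq_trans (gB a b nab) _.
  rewrite -(card_imset _ (@inj_join H)); apply/subset_leq_card/subsetP=> w.
  case/imsetP=> z /setIP[zB zab] ->.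
  by rewrite !inE imset_f ?imset_f ?orbT // !inE zB orbT.
have [T] := adj2_basis_exists (K1_join H); rewrite adj2_basisE => /andP[gT /eqP <-].
have NxT : [set None; Some x] \subset T.
  have sub : T :&: distinguishers (None : K1_join H) (Some x)
             \subset [set None; Some x].
    (* Any third vertex is adjacent to both [None] and [Some x]. *)
    apply/subsetP=> -[z|]; rewrite !inE //= !dist2E => /andP[_].
    by apply: contraNT => nzx; rewrite /= [Some x == _]eq_sym (negbTE nzx) xE.
  (* A generator needs two separators and only two exist, so [T] contains both. *)
  have /eqP <- : T :&: distinguishers (None : K1_join H) (Some x)
                 == [set None; Some x].
    by rewrite eqEcard sub cards2; move/adj2_generatorP: gT; apply.
  exact: subsetIl.
(* [None] accounts for one of the two extra units; the other is the strict inequality between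
   [adim2 H] and the size of the trace. *)
rewrite card_trace (subsetP NxT) ?set21 // addn2 add1n ltnS.
have gS := join_generator_trace _ _ gT.
rewrite ltn_neqAle adim2_le // andbT.
(* Equality would make the trace a basis containing [x]. *)
have : ~~ adj2_basis [set a : H | Some a \in T].
  apply: contraL (_ : x \in [set a : H | Some a \in T]) => [/xB//|].
  by rewrite inE (subsetP NxT) ?set22.
by rewrite adj2_basisE gS eq_sym.
Qed.
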